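(* Let $q=p=1$. There exist infinite families of branching geodesics and of deviant geodesics in $(\mathcal{D}_p[l^q], d_p[l^q])$.
   Context: Let $\Delta=\{(x,x):x\in\mathbb{R}\}\subset\mathbb{R}^2$ and $\mathbb{R}^2_>=\{(a,b)\in\mathbb{R}^2: b>a\}$. A persistence diagram is a countable subset of $\mathbb{R}^2_>\times\mathbb{N}$ together with countably infinitely many copies of $\Delta$ (i.e. every point of $\Delta$ is counted with countably infinite multiplicity). The $\mathbb{R}^2$-component of a point is its geometric component; the $\mathbb{N}$-component is an index that only serves to distinguish different copies of the same geometric point, so that a diagram encodes a multiset in $\mathbb{R}^2$. The set of all persistence diagrams is $\mathcal{D}$. The empty diagram $\varnothing$ consists only of the diagonal with countably infinite multiplicity. For points $x,y$ of diagrams, $\|x-y\|_q$ denotes the $q$-norm in $\mathbb{R}^2$ of the difference of their geometric components (the index is ignored). For $p\in[1,\infty)$, $q\in[1,\infty]$, $X,Y\in\mathcal{D}$ and a bijection $\varphi:X\to Y$ (all diagonal copies included), put $C_p[l^q](\varphi)=\left(\sum_{x\in X}\|x-\varphi(x)\|_q^p\right)^{1/p}$. Define $d_p[l^q](X,Y)=\inf\{C_p[l^q](\varphi): \varphi:X\to Y \text{ a bijection}\}\in[0,\infty]$; a bijection attaining the infimum is called optimal. Let $\mathcal{D}_p[l^q]=\{X\in\mathcal{D}: d_p[l^q](X,\varnothing)<\infty\}$. A geodesic in $\mathcal{D}_p[l^q]$ is a continuous map $\gamma:[0,1]\to\mathcal{D}_p[l^q]$ with $d_p[l^q](\gamma(s),\gamma(t))=|t-s|\,d_p[l^q](\gamma(0),\gamma(1))$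 for all $s,t\in[0,1]$; it is a geodesic from $\gamma(0)$ to $\gamma(1)$. A convex-combination geodesic from $X$ to $Y$ is a geodesic of the form $\gamma(0)=X$, $\gamma(1)=Y$, $\gamma(t)=\{(1-t)x+t\varphi(x):x\in X\}$ for $t\in(0,1)$, where $\varphi:X\to Y$ is an optimal bijection; here $\gamma(t)$ is understood as a multiset of geometric points (diagonal with countably infinite multiplicity), the indexing coordinates being ignored. A geodesic not of this form (indexing coordinates again being ignored) is called deviant. A geodesic $\gamma:[0,1]\to\mathcal{D}_p[l^q]$ branches at $t_0\in(0,1)$ (and is called a branching geodesic) if there exists a geodesic $\widetilde\gamma:[0,1]\to\mathcal{D}_p[l^q]$ that agrees with $\gamma$ on $[0,t_0]$ and is distinct from $\gamma$ on $(t_0,t_0+\varepsilon]$ for some $\varepsilon>0$. *)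

(* Defs.v *)
From HB Require Import structures.
From mathcomp Require Import all_boot all_order all_algebra.
From mathcomp Require Import all_classical all_reals all_analysis.
Set Implicit Arguments.
Unset Strict Implicit.
Unset Printing Implicit Defensive.
Import Order.TTheory GRing.Theory Num.Theory.
Import numFieldNormedType.Exports.
Local Open Scope card_scope.
Local Open Scope classical_set_scope.
Local Open Scope ring_scope.

(* A point of a diagram is a pair (geometric component, index). *)
Notation dpoint R := ((R * R) * nat)%type.

(* Only the off-diagonal part of a diagram is data: the diagonal part is the
   same in all diagrams and is added by [points] below. *)
Record diagram (R : realType) := Diagram {
  offdiag :> set (dpoint R) ;
  offdiag_gt : forall x, offdiag x -> x.1.1 < x.1.2 ;
  offdiag_countable : countable offdiag }.

Section Diagrams.
Variable R : realType.
Implicit Types (X Y : diagram R) (p : R) (q : \bar R).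

(* The copies of a diagonal point (a, a) are ((a, a), n) for all n : nat. *)
Definition points X : set (dpoint R) :=
  offdiag X `|` [set x | x.1.1 = x.1.2].

Lemma empty_gt (x : dpoint R) : set0 x -> x.1.1 < x.1.2.
Proof. by []. Qed.

Definition empty_diagram : diagram R :=
  Diagram empty_gt (@countable0 (dpoint R)).

(* Only 1 <= q is meaningful; the value at -oo is junk. *)
Definition qnorm q (v : R * R) : R :=
  match q with
  | r%:E => (`|v.1| `^ r + `|v.2| `^ r) `^ r^-1
  | +oo%E => Num.max `|v.1| `|v.2|
  | -oo%E => 0
  end.

Definition bijection X Y (phi : dpoint R -> dpoint R) : Prop :=
  set_bij (points X) (points Y) phi.

(* The sum ranges over the uncountable set [points X]; [esum] is the supremum
   of the finite partial sums. *)
Definition cost p q X (phi : dpoint R -> dpoint R) : \bar R :=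
  poweR (\esum_(x in points X) (qnorm q (x.1 - (phi x).1) `^ p)%:E) p^-1.

Definition dist p q X Y : \bar R :=
  ereal_inf [set cost p q X phi | phi in bijection X Y].

Definition optimal p q X Y (phi : dpoint R -> dpoint R) : Prop :=
  bijection X Y phi /\ cost p q X phi = dist p q X Y.

Definition Dp p q : set (diagram R) :=
  [set X | (dist p q X empty_diagram < +oo)%E].

(* Equality as multisets of geometric points: every point of the plane has the
   same number of copies (finite or countably infinite) in X and in Y. *)
Definition geom_eq X Y : Prop :=
  forall a : R * R, [set n | offdiag X (a, n)] #= [set n | offdiag Y (a, n)].

(* Paths are total functions on R of which only the values on [0, 1] are
   relevant; [path_eq] is equality on [0, 1], the indices being ignored. *)
Definition path_eq (g h : R -> diagram R) : Prop :=
  forall t : R, t \in `[0, 1] -> geom_eq (g t) (h t).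

(* Continuity is with respect to the distance; it is spelled out because
   [diagram] carries no topology. *)
Definition dist_continuous p q (g : R -> diagram R) : Prop :=
  forall t : R, t \in `[0, 1] ->
    dist p q (g s) (g t) @[s --> within `[0, 1] (nbhs t)] --> 0%E.

Definition geodesic p q (g : R -> diagram R) : Prop :=
  [/\ forall t : R, t \in `[0, 1] -> Dp p q (g t),
      dist_continuous p q g
    & forall s t : R, s \in `[0, 1] -> t \in `[0, 1] ->
        (dist p q (g s) (g t) = `|t - s|%:E * dist p q (g 0%R) (g 1%R))%E].

Definition convex_comb (t : R) (a b : R * R) : R * R :=
  ((1 - t) * a.1 + t * b.1, (1 - t) * a.2 + t * b.2).

(* Z is the multiset of the points (1 - t) x + t phi(x), x in X. Multiplicities
   are compared off the diagonal only: that of the diagonal is always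
   countably infinite by convention. *)
Definition is_interpolation X (phi : dpoint R -> dpoint R) (t : R)
    (Z : diagram R) : Prop :=
  forall a : R * R, a.1 < a.2 ->
    [set n | offdiag Z (a, n)] #=
    [set x | points X x /\ convex_comb t x.1 (phi x).1 = a].

Definition convex_combination_geodesic p q (g : R -> diagram R) : Prop :=
  geodesic p q g /\
  exists phi, optimal p q (g 0) (g 1) phi /\
    forall t : R, t \in `]0, 1[ -> is_interpolation (g 0) phi t (g t).

Definition deviant p q (g : R -> diagram R) : Prop :=
  geodesic p q g /\ ~ convex_combination_geodesic p q g.

Definition branches_at p q (g : R -> diagram R) (t0 : R) : Prop :=
  exists h : R -> diagram R,
    [/\ geodesic p q h,
        (forall t : R, t \in `[0, t0] -> geom_eq (h t) (g t))
      & (exists e : R, [/\ 0 < e, t0 + e <= 1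
          & (forall t : R, t0 < t <= t0 + e -> ~ geom_eq (h t) (g t))])].

Definition branching p q (g : R -> diagram R) : Prop :=
  geodesic p q g /\ exists t0, 0 < t0 < 1 /\ branches_at p q g t0.

(* Infinitely many paths satisfy P, even after identifying the paths that
   differ only by the indices of their points. *)
Definition infinite_family (P : (R -> diagram R) -> Prop) : Prop :=
  exists F : nat -> R -> diagram R,
    (forall n, P (F n)) /\ (forall m n, m <> n -> ~ path_eq (F m) (F n)).

End Diagrams.

(* Main.v *)
Require Import Defs.
From mathcomp Require Import all_boot all_order all_algebra.
From mathcomp Require Import all_classical all_reals all_analysis.
From mathcomp Require Import ring lra.
Import Order.TTheory GRing.Theory Num.Theory.
Import numFieldNormedType.Exports.
Local Open Scope card_scope.
Local Open Scope classical_set_scope.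
Local Open Scope ring_scope.

(** A diagram with a single off-diagonal point [a] has persistence
    [a.2 - a.1], and in the case [p = q = 1] persistence is 1-Lipschitz for the
    distance.  Hence every path of the point [a] that moves left and up at unit
    l^1 speed is a geodesic, whatever its shape.  The paths starting at (0, 1)
    that go left until time [c] and then up are therefore geodesics; they
    branch at time [c] from the path that keeps going left, and they are
    deviant because the trajectory has a corner at time [c]. *)

Section OnePointDiagrams.
Context {R : realType}.
Implicit Types (a b : R * R) (X Y : diagram R).

(** * Diagrams with one off-diagonal point *)

(* Empty (a junk value) if [a] is not above the diagonal. *)
Definition one_point a : set (dpoint R) :=
  [set x | x = (a, 0%N) /\ a.1 < a.2].

Lemma one_point_gt a x : one_point a x -> x.1.1 < x.1.2.
Proof. by move=> [->]. Qed.

Lemma one_point_countable a : countable (one_point a).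
Proof.
apply: finite_set_countable; apply: (@sub_finite_set _ _ [set (a, 0%N)]) => //.
by move=> x [].
Qed.

Definition single a : diagram R :=
  Diagram (@one_point_gt a) (one_point_countable a).

Lemma geom_eq_single a b :
  a.1 < a.2 -> geom_eq (single a) (single b) -> a = b.
Proof.
move=> a12 /(_ a) ab; apply: contrapT => nab; move: ab.
rewrite (_ : [set n | offdiag (single b) (a, n)] = set0).
  by rewrite card_eq0 => /eqP/seteqP[/(_ 0%N) + _]; apply.
by apply/seteqP; split => // n [[/nab]].
Qed.

(** * The cost of a bijection for p = q = 1 *)

Definition l1norm (v : R * R) : R := `|v.1| + `|v.2|.

Lemma l1norm_ge0 v : 0 <= l1norm v.
Proof. exact: addr_ge0. Qed.

Lemma cost11 X (phi : dpoint R -> dpoint R) :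
  cost 1 1%:E X phi = \esum_(x in points X) (l1norm (x.1 - (phi x).1))%:E.
Proof.
rewrite /cost invr1 poweRe1; last first.
  by apply: esum_ge0 => x _; rewrite lee_fin powR_ge0.
apply: eq_esum => x _; congr _%:E.
by rewrite /qnorm invr1 !powRr1// addr_ge0.
Qed.

Lemma cost11_ge X (phi : dpoint R -> dpoint R) x : points X x ->
  ((l1norm (x.1 - (phi x).1))%:E <= cost 1 1%:E X phi)%E.
Proof.
move=> Xx; rewrite cost11; apply: esum_ge; exists [set x].
  by split => // _ ->.
by rewrite fsbig_set1.
Qed.

(** Serves the upper bounds on distances, which come from explicit bijections moving one point;
    re-indexing the other points is free. *)
Lemma cost11_one_move X (phi : dpoint R -> dpoint R) x : points X x ->
  (forall y, points X y -> y <> x -> (phi y).1 = y.1) ->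
  cost 1 1%:E X phi = (l1norm (x.1 - (phi x).1))%:E.
Proof.
move=> Xx phi_id; rewrite cost11.
pose f y := (l1norm (y.1 - (phi y).1))%:E.
rewrite -[RHS]/(f x) -(@esum_set1 _ _ x f) ?lee_fin ?l1norm_ge0//.
rewrite -[in RHS](@setIidr _ (points X) [set x]); last by move=> _ ->.
rewrite esum_mkcondr; apply: eq_esum => y Xy; case: ifPn => //.
rewrite notin_setE /= => yx; rewrite phi_id// subrr /l1norm /=.
by rewrite normr0 addr0.
Qed.

(** * Distances between one-point diagrams *)

Lemma l1norm_ge_persistence (a b : R * R) :
  `|(b.2 - b.1) - (a.2 - a.1)| <= l1norm (a - b).
Proof.
rewrite /l1norm /= (_ : _ - _ = (a.1 - b.1) - (a.2 - b.2)); last by ring.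
exact: ler_normB.
Qed.

Lemma points_single_le a x : points (single a) x -> a.1 < a.2 ->
  x.1.2 - x.1.1 <= a.2 - a.1.
Proof. by move=> [[-> _]|/= ->] // ?; rewrite subrr subr_ge0 ltW. Qed.

Lemma points_single a : a.1 < a.2 -> points (single a) (a, 0%N).
Proof. by move=> a12; left. Qed.

(** Whichever of [a] and [b] has the larger persistence is matched with a point of the other
    diagram, whose persistence is at most that of its off-diagonal point. This single match already
    costs the difference. *)
Lemma dist_single_ge a b : a.1 < a.2 -> b.1 < b.2 ->
  (`|(b.2 - b.1) - (a.2 - a.1)|%:E <=
   dist 1 1%:E (single a) (single b))%E.
Proof.
move=> a12 b12; apply: le_ereal_inf_tmp => _ [phi [phi_fun _ phi_surj] <-].
have [ab|ba] := leP (a.2 - a.1) (b.2 - b.1).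
- have [x Xx phix] := phi_surj _ (points_single b b12).
  apply: le_trans (cost11_ge _ phi _ Xx); rewrite lee_fin phix.
  apply: le_trans (l1norm_ge_persistence _ _).
  by have := points_single_le _ _ Xx a12; move=> xa; rewrite !ger0_norm; lra.
- apply: le_trans (cost11_ge _ phi _ (points_single a a12)); rewrite lee_fin.
  apply: le_trans (l1norm_ge_persistence _ _).
  have := points_single_le _ _ (phi_fun _ (points_single a a12)) b12.
  by move=> xb; rewrite !ler0_norm; lra.
Qed.

Lemma dist_single_le a b : a.1 < a.2 -> b.1 < b.2 ->
  (dist 1 1%:E (single a) (single b) <= (l1norm (a - b))%:E)%E.
Proof.
move=> a12 b12.
pose phi (x : dpoint R) := if x == (a, 0%N) then (b, 0%N) else x.
have phia : phi (a, 0%N) = (b, 0%N) by rewrite /phi eqxx.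
have phid x : x.1.1 = x.1.2 -> phi x = x.
  move=> x12; rewrite /phi; case: eqP => // xa.
  by move: a12; rewrite xa /= in x12; rewrite x12 ltxx.
apply: ge_ereal_inf; exists (cost 1 1%:E (single a) phi); last first.
  rewrite (cost11_one_move _ _ (a, 0%N)) ?phia//; first exact: points_single.
  by move=> y _ /eqP/negbTE ya; rewrite /phi ya.
exists phi => //; split.
- by move=> x [[-> _]|x12]; [rewrite phia; left|rewrite phid//; right].
- move=> x y /set_mem[[-> _]|x12] /set_mem[[-> _]|y12] //.
  + rewrite phia phid// => by0; move: b12.
    by rewrite -by0 /= in y12; rewrite y12 ltxx.
  + rewrite phia phid// => xb0; move: b12.
    by rewrite xb0 /= in x12; rewrite x12 ltxx.
  + by rewrite !phid.
- move=> y [[-> _]|y12].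
    by exists (a, 0%N); [exact: points_single|rewrite phia].
  by exists y; [right|rewrite phid].
Qed.

(** Any bijection of finite cost suffices, so [a] is sent to the origin and all other points stay in
    place geometrically. *)
Lemma Dp_single a : a.1 < a.2 -> Dp 1 1%:E (single a).
Proof.
move=> a12.
have a0 : (a == 0) = false.
  by apply/eqP => a0; move: a12; rewrite a0 ltxx.
(* Inserting one more copy of the diagonal point 0 shifts its indices. *)
pose phi (x : dpoint R) : dpoint R :=
  if x == (a, 0%N) then (0, 0%N) else if x.1 == 0 then (0, x.2.+1) else x.
have phia : phi (a, 0%N) = (0, 0%N) by rewrite /phi eqxx.
have phid x : x.1.1 = x.1.2 -> phi x = if x.1 == 0 then (0, x.2.+1) else x.
  move=> x12; rewrite /phi; case: eqP => // xa.
  by move: a12; rewrite xa /= in x12; rewrite x12 ltxx.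
have phi_id y : y <> (a, 0%N) -> (phi y).1 = y.1.
  by move=> /eqP/negbTE ya; rewrite /phi ya; case: eqP.
rewrite /Dp /=.
apply: (@le_lt_trans _ _ (cost 1 1%:E (single a) phi)); last first.
  rewrite (cost11_one_move _ _ (a, 0%N)) ?ltry//; first exact: points_single.
  by move=> y _; exact: phi_id.
apply: ereal_inf_lbound; exists phi => //; split.
- move=> x Xx; right; case: Xx => [[-> _]|x12]; first by rewrite phia.
  by rewrite phid//; case: ifP.
- move=> [x m] [y n] /set_mem[[-> _]|x12] /set_mem[[-> _]|y12] //.
  + by rewrite phia phid//=; case: eqP => // y0 [] /esym/y0.
  + by rewrite phia phid//=; case: eqP => // x0 [] /x0.
  + rewrite !phid//=; case: eqP => [->|x0]; case: eqP => [->|y0] //.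
    * by move=> [->].
    * by move=> [] /esym/y0.
    * by move=> [] /x0.
- move=> [y n] [[]|/= y12] //; have [->|y0] := eqVneq y 0.
    case: n => [|n].
      by exists (a, 0%N); [exact: points_single|rewrite phia].
    by exists (0, n); [right|rewrite phid//= eqxx].
  by exists (y, n); [right|rewrite phid//= (negbTE y0)].
Qed.

(** * Interpolations between one-point diagrams *)

Lemma points_convex_comb_gt X (t : R) a y : a.1 < a.2 -> points X y ->
  t \in `]0, 1[ -> (convex_comb t a y.1).1 < (convex_comb t a y.1).2.
Proof.
move=> a12 Xy; rewrite in_itv /= => /andP[t0 t1].
have y12 : y.1.1 <= y.1.2 by case: Xy => [/offdiag_gt/ltW|/= ->].
by rewrite /convex_comb /= ltr_leD// ?ltr_pM2l ?subr_gt0// ler_pM2l.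
Qed.

(** The interpolated point of [a] is above the diagonal even if its partner is diagonal, so its
    multiplicity counts. It is nonzero because of [a], and [single c] has no other off-diagonal
    point than [c]. *)
Lemma interpolation_single a b c (t : R) (phi : dpoint R -> dpoint R) :
  a.1 < a.2 -> bijection (single a) (single b) phi -> t \in `]0, 1[ ->
  is_interpolation (single a) phi t (single c) ->
  c = convex_comb t a (phi (a, 0%N)).1.
Proof.
move=> a12 [phi_fun _ _] t01.
have Xa := points_single a a12.
move=> /(_ _ (points_convex_comb_gt _ _ _ _ a12 (phi_fun _ Xa) t01)) eqc.
apply: contrapT => nc; move: eqc.
rewrite (_ : [set n | offdiag (single c) _] = set0).
  rewrite card_eq_sym card_eq0 => /eqP/seteqP[/(_ (a, 0%N)) + _]; apply.
  by split.
by apply/seteqP; split => // n [[/esym/nc]].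
Qed.

(** * Elbow-shaped paths as branching and deviant geodesics *)

(* The absolute value keeps the point above the diagonal for t < 0 as well. *)
Definition elbow (c t : R) : R * R :=
  (- Num.min `|t| c, 1 + (`|t| - Num.min `|t| c)).

Lemma elbow_gt c t : (elbow c t).1 < (elbow c t).2.
Proof. by rewrite /elbow /=; have := normr_ge0 t; lra. Qed.

Lemma elbow_inj c d t :
  elbow c t = elbow d t -> Num.min `|t| c = Num.min `|t| d.
Proof. by move=> [/oppr_inj]. Qed.

Definition elbow_path (c t : R) : diagram R := single (elbow c t).

(** The persistence at time [t] is [1 + t], and the l^1 displacement is exactly [|t - s|], so the
    lower and upper bounds meet. *)
Lemma dist_elbow c s t : 0 <= s -> 0 <= t ->
  dist 1 1%:E (elbow_path c s) (elbow_path c t) = `|t - s|%:E.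
Proof.
move=> s0 t0; apply/eqP; rewrite eq_le; apply/andP; split; last first.
  apply: le_trans (dist_single_ge _ _ (elbow_gt c s) (elbow_gt c t)).
  rewrite lee_fin /elbow /= (ger0_norm s0) (ger0_norm t0).
  by rewrite le_eqVlt; apply/predU1P; left; congr `|_|; ring.
apply: le_trans (dist_single_le _ _ (elbow_gt c s) (elbow_gt c t)) _.
rewrite lee_fin /l1norm /elbow /= (ger0_norm s0) (ger0_norm t0).
(* Both [min t c] and [t - min t c] are nondecreasing in [t], which fixes the signs of the two
   coordinate differences. *)
have [st|/ltW ts] := leP s t.
- rewrite (ger0_norm (_ : 0 <= t - s)) ?subr_ge0//.
  rewrite ger0_norm; last by rewrite /Num.min; case: ifP; case: ifP; lra.
  by rewrite ler0_norm; rewrite /Num.min; case: ifP; case: ifP; lra.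
- rewrite (ler0_norm (_ : t - s <= 0)) ?subr_le0//.
  rewrite ler0_norm; last by rewrite /Num.min; case: ifP; case: ifP; lra.
  by rewrite ger0_norm; rewrite /Num.min; case: ifP; case: ifP; lra.
Qed.

Lemma geodesic_elbow c : geodesic 1 1%:E (elbow_path c).
Proof.
split.
- by move=> t _; apply: Dp_single; exact: elbow_gt.
- move=> t; rewrite in_itv /= => /andP[t0 _].
  have : `|t - s|%:E @[s --> within `[0, 1] (nbhs t)] --> (0%E : \bar R).
    apply: cvg_within_filter; apply: cvg_EFin; first by near=> s.
    have : `|t - s| @[s --> t] --> `|t - t|.
      by apply: cvg_norm; apply: cvgB; [exact: cvg_cst|exact: cvg_id].
    by rewrite subrr normr0.
  apply: cvg_trans; apply: near_eq_cvg.
  near=> s; rewrite dist_elbow//.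
  have /= : s \in `[0, 1] by near: s; exact: withinT.
  by rewrite in_itv /= => /andP[].
- move=> s t; rewrite !in_itv /= => /andP[s0 _] /andP[t0 _].
  by rewrite !dist_elbow// subr0 normr1 mule1.
Unshelve. all: by end_near. Qed.

Lemma branching_elbow c : 0 < c < 1 -> branching 1 1%:E (elbow_path c).
Proof.
move=> /andP[c0 c1]; split; first exact: geodesic_elbow.
exists c; split; first by rewrite c0.
(* With parameter 1 the path does not turn before time 1. *)
exists (elbow_path 1); split; first exact: geodesic_elbow.
- move=> t; rewrite in_itv /= => /andP[t0 tc].
  rewrite /elbow_path (_ : elbow 1 t = elbow c t) => [a|].
    exact: card_eqxx.
  by rewrite /elbow ger0_norm// !min_l// (le_trans tc)// ltW.
- exists (1 - c); split; [lra|lra|].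
  move=> t /andP[ct t1] /(geom_eq_single _ _ (elbow_gt _ _))/elbow_inj.
  have t0 : 0 < t by lra.
  have t1' : t <= 1 by lra.
  rewrite gtr0_norm// (min_l t1') (min_r (ltW ct)) => tc.
  by rewrite tc ltxx in ct.
Qed.

Lemma deviant_elbow c : 0 < c < 1 -> deviant 1 1%:E (elbow_path c).
Proof.
move=> /andP[c0 c1]; split; first exact: geodesic_elbow.
move=> [_ [phi [[phi_bij _] interp]]].
have E t : t \in `]0, 1[ -> elbow c t =
    convex_comb t (elbow c 0) (phi (elbow c 0, 0%N)).1.
  move=> t01; apply: interpolation_single (interp t t01) => //.
    exact: elbow_gt.
  exact: phi_bij.
(* At both times [c] and [m > c] the first coordinate is [-c]. A convex combination starting at 0
   has first coordinate [t * u], so time [c] forces [u = -1], and time [m] then gives [m = c]. *)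
pose m := (c + 1) / 2.
have := E m; have := E c; rewrite !in_itv /= /m.
move=> /(_ ltac:(lra)) + /(_ ltac:(lra)).
rewrite /elbow /convex_comb /= normr0 (min_l (ltW c0)).
rewrite !gtr0_norm ?addr_gt0//; last by lra.
rewrite minxx (@min_r _ _ ((c + 1) / 2) c); last by lra.
set u := (phi _).1.1.
move=> [+ _] [+ _] => E1 E2.
have u1 : c * (u + 1) = 0 by lra.
have : u + 1 = 0 by move/eqP: u1; rewrite mulf_eq0 gt_eqF//= => /eqP.
by move=> u1'; have uN : u = -1 by [lra]; rewrite uN in E2; lra.
Qed.

(** The first coordinate at time 1 is [-c], so the endpoint determines the parameter. *)
Lemma path_eq_elbow c d : c <= 1 -> d <= 1 ->
  path_eq (elbow_path c) (elbow_path d) -> c = d.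
Proof.
move=> c1 d1 /(_ 1); rewrite in_itv /= ler01 lexx => /(_ isT).
move=> /(geom_eq_single _ _ (elbow_gt _ _))/elbow_inj.
by rewrite normr1 !min_r.
Qed.

Lemma infinite_family_elbow (P : (R -> diagram R) -> Prop) :
  (forall c, 0 < c < 1 -> P (elbow_path c)) -> infinite_family P.
Proof.
(* The shift by 2 keeps every turning time strictly between 0 and 1. *)
move=> Pelbow; exists (fun n => elbow_path n.+2%:R^-1).
have n1 n : n.+2%:R^-1 < 1 :> R by rewrite invf_lt1 ?ltr0n// ltr1n.
split => [n|m n mn].
  by apply: Pelbow; rewrite invr_gt0 ltr0n n1.
move=> /path_eq_elbow; rewrite !ltW// => /(_ isT isT)/invr_inj/eqP.
by rewrite eqr_nat => /eqP[].
Qed.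

End OnePointDiagrams.

Theorem theorem9 (R : realType) (p : R) (q : \bar R)
    (hp : p = 1) (hq : q = 1%:E) :
  infinite_family (branching p q) /\ infinite_family (deviant p q).
Proof.
rewrite hp hq; split; apply: infinite_family_elbow.
- exact: branching_elbow.
- exact: deviant_elbow.
Qed.
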